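(* Let $n=3$. There exists a data vector $u=(u_I)_{I\subseteq[3]}$ in the determinantal point process model $\mathcal{M}_3$ such that the parametric log-likelihood function $$L_u(\Theta)=\Bigl(\sum_{I\subseteq[3]}u_I\log\det(\Theta_I)\Bigr)-\Bigl(\sum_{I\subseteq[3]}u_I\Bigr)\log\det(\Theta+\mathrm{Id}_3),$$ regarded as a function on the cone of positive-definite real symmetric $3\times3$ matrices $\Theta$, has critical points that are not partial decouplings for $u$. Consequently, the following conjecture is false: for every $n$ and every $u\in\mathcal{M}_n$, all critical points of $L_u$ on the cone of positive-definite real symmetric $n\times n$ matrices are partial decouplings for $u$.
   Context: Notation. $[n]=\{1,\dots,n\}$. For an $n\times n$ matrix $\Theta$ and $I\subseteq[n]$, $\Theta_I$ is the principal submatrix with rows and columns indexed by $I$, and $\det(\Theta_\emptyset)=1$. $\mathrm{Id}_n$ is the identity matrix; one has $\sum_{I\subseteq[n]}\det(\Theta_I)=\det(\Theta+\mathrm{Id}_n)$. The determinantal point process model $\mathcal{M}_n$ is the set of probability distributions $p=(p_I)_{I\subseteq[n]}$ on the subsets of $[n]$ of the form $p_I=\det(\Theta_I)/\det(\Theta+\mathrm{Id}_n)$ with $\Theta$ a positive-definite real symmetric $n\times n$ matrix. A nonnegative data vector $u$ is regarded as lying in $\mathcal{M}_n$ if $u/\sum_I u_I\in\mathcal{M}_n$; equivalently, $u/u_\emptyset$ is the vector of principal minors of some positive-definite real symmetric matrix. (Rescaling $u$ by a positive constant does not change the critical points of $L_u$.) For general $n$, the parametric log-likelihood is $L_u(\Theta)=\sum_{I\subseteq[n]}u_I\log\det(\Theta_I)-\bigl(\sum_{I\subseteq[n]}u_I\bigr)\log\det(\Theta+\mathrm{Id}_n)$.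 A critical point is a matrix $\Theta$ at which all partial derivatives of $L_u$ with respect to the independent entries $\theta_{ij}$, $i\le j$ (where $\theta_{ji}=\theta_{ij}$), vanish. Partial decouplings. Let $u\in\mathcal{M}_n$ and let $\pi=\{\pi_1,\dots,\pi_k\}$ be a set partition of $[n]$ into nonempty blocks. For each $i$ and each $J\subseteq\pi_i$ put $v^{(i)}_J=\sum\{u_I: I\subseteq[n],\ I\cap\pi_i=J\}$. A partial decoupling for $u$ according to $\pi$ is a positive-definite real symmetric matrix $\Theta$ that is block diagonal with respect to $\pi$ (that is, $\theta_{ab}=0$ whenever $a,b$ lie in different blocks of $\pi$) and such that, for each $i$, $\det(\Theta_J)=v^{(i)}_J/v^{(i)}_\emptyset$ for all $J\subseteq\pi_i$. Thus the determinantal point process of $\Theta$ has the same marginal law on each block $\pi_i$ as the distribution $u/\sum_I u_I$, and the blocks are independent. A partial decoupling for $u$ is a partial decoupling according to some set partition $\pi$ of $[n]$; for $\pi=\{[n]\}$ these are the positive-definite matrices whose principal minors are $u_I/u_\emptyset$. *)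

(* Defs.v *)
From HB Require Import structures.
From mathcomp Require Import all_boot all_order all_algebra.
From mathcomp Require Import all_classical all_reals all_analysis.
Import Order.TTheory GRing.Theory Num.Theory.
Import numFieldNormedType.Exports.

Set Implicit Arguments.
Unset Strict Implicit.
Unset Printing Implicit Defensive.

Local Open Scope ring_scope.

(* The ground set [n] = {1, ..., n} is the type 'I_n, and a vector indexed by
   the subsets of [n] is a function {set 'I_n} -> R. *)

(* Rows and columns in I, listed in the order of 'I_n; for I = set0 this is the
   0 x 0 matrix, whose determinant is 1. *)
Definition principal_submx (R : realType) (n : nat) (Theta : 'M[R]_n)
    (I : {set 'I_n}) : 'M[R]_#|I| :=
  \matrix_(i < #|I|, j < #|I|) Theta (enum_val i) (enum_val j).

Definition principal_minor (R : realType) (n : nat) (Theta : 'M[R]_n)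
    (I : {set 'I_n}) : R :=
  \det (principal_submx Theta I).

Definition posdefmx (R : realType) (n : nat) (Theta : 'M[R]_n) : Prop :=
  Theta^T = Theta /\
  forall x : 'cV[R]_n, x != 0 -> 0 < (x^T *m Theta *m x) 0 0.

Definition distribution_on_subsets (R : realType) (n : nat)
    (p : {set 'I_n} -> R) : Prop :=
  (forall I, 0 <= p I) /\ \sum_(I : {set 'I_n}) p I = 1.

Definition dpp_model (R : realType) (n : nat) (p : {set 'I_n} -> R) : Prop :=
  distribution_on_subsets p /\
  exists Theta : 'M[R]_n, posdefmx Theta /\
    forall I, p I = principal_minor Theta I / \det (Theta + 1%:M).

(* Nonnegative data vectors belong to the model up to normalization. *)
Definition data_in_dpp_model (R : realType) (n : nat)
    (u : {set 'I_n} -> R) : Prop :=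
  (forall I, 0 <= u I) /\
  dpp_model (fun I => u I / \sum_(J : {set 'I_n}) u J).

(* The function is total on 'M[R]_n because ln is total; only its values at
   positive-definite matrices are meaningful. *)
Definition log_likelihood (R : realType) (n : nat) (u : {set 'I_n} -> R)
    (Theta : 'M[R]_n) : R :=
  \sum_(I : {set 'I_n}) u I * ln (principal_minor Theta I)
  - (\sum_(I : {set 'I_n}) u I) * ln (\det (Theta + 1%:M)).

(* Since theta_ij and theta_ji are the same coordinate, moving it moves both
   entries when i <> j. *)
Definition sym_dir (R : realType) (n : nat) (i j : 'I_n) : 'M[R]_n :=
  if i == j then delta_mx i i else delta_mx i j + delta_mx j i.

Definition critical_point (R : realType) (n : nat) (u : {set 'I_n} -> R)
    (Theta : 'M[R]_n) : Prop :=
  posdefmx Theta /\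
  forall i j : 'I_n, (i <= j)%N ->
    is_derive Theta (sym_dir R i j) (log_likelihood u) (0 : R).

Definition marginal (R : realType) (n : nat) (u : {set 'I_n} -> R)
    (B J : {set 'I_n}) : R :=
  \sum_(I : {set 'I_n} | I :&: B == J) u I.

Definition partial_decoupling_according_to (R : realType) (n : nat)
    (u : {set 'I_n} -> R) (P : {set {set 'I_n}}) (Theta : 'M[R]_n) : Prop :=
  [/\ posdefmx Theta,
      forall A B : {set 'I_n}, A \in P -> B \in P -> A != B ->
        forall a b : 'I_n, a \in A -> b \in B -> Theta a b = 0
    & forall B J : {set 'I_n}, B \in P -> J \subset B ->
        principal_minor Theta J = marginal u B J / marginal u B finset.set0].

Definition partial_decoupling (R : realType) (n : nat)
    (u : {set 'I_n} -> R) (Theta : 'M[R]_n) : Prop :=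
  exists2 P : {set {set 'I_n}}, finset.partition P [set: 'I_n] &
    partial_decoupling_according_to u P Theta.

(* Main.v *)
(* Write a subset of [3] as a sign vector s and take Theta = (1 + B) / (1 - B)
   with B symmetric, of zero diagonal and with B_12 B_13 B_23 = 0: the
   distribution of Theta is then
     (1 - B_12^2 s_1 s_2 - B_13^2 s_1 s_3 - B_23^2 s_2 s_3) / 8.
   Fit data whose B is supported on the path 1 - 2 - 3 by matrices whose B is
   supported on the other path 2 - 1 - 3.  The likelihood is stationary in B_23
   because only B_23^2 and the product of the three entries occur, the latter
   multiplied by an odd moment that vanishes; it is stationary in the diagonal
   by the symmetry s -> -s.  The two remaining equations, in B_12 = a and
   B_13 = b, hold when the data have squared weights a^2 - b^4 / a^2 and
   b^2 / a^2; here a = 1/2 and b = 1/4.  Such a matrix is not block diagonal and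
   has the wrong principal minors.  The data cannot be chosen with rational
   weights, as a^4 - b^4 is never a nonzero rational square, whence sqrt 15. *)

Require Import Defs.
From mathcomp Require Import all_boot all_order all_algebra.
From mathcomp Require Import all_classical all_reals all_analysis.
From mathcomp Require Import ring lra.
Import Order.TTheory GRing.Theory Num.Theory.
Import numFieldNormedType.Exports.

Set Implicit Arguments.
Unset Strict Implicit.
Unset Printing Implicit Defensive.

Local Open Scope ring_scope.

(** * Subsets of a three-element set as triples of Booleans *)

Lemma forall_ord3 (P : 'I_3 -> Prop) :
  P ord0 -> P (lift ord0 ord0) -> P ord_max -> forall i, P i.
Proof.
move=> P0 P1 P2 [[|[|[|//]]] lti].
- by congr P: P0; apply: val_inj.
- by congr P: P1; apply: val_inj.
- by congr P: P2; apply: val_inj.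
Qed.

Definition set3 (a b c : bool) : {set 'I_3} :=
  [set i : 'I_3 | nth false [:: a; b; c] i].

Lemma set3E (A : {set 'I_3}) :
  A = set3 (ord0 \in A) (lift ord0 ord0 \in A) (ord_max \in A).
Proof. by apply/setP; apply: forall_ord3; rewrite inE. Qed.

Lemma set0_set3 : finset.set0 = set3 false false false.
Proof. by apply/setP; apply: forall_ord3; rewrite !inE. Qed.

Lemma sum_set3 (V : nmodType) (F : {set 'I_3} -> V) :
  \sum_A F A = \sum_(a : bool) \sum_(b : bool) \sum_(c : bool) F (set3 a b c).
Proof.
pose mk (t : bool * (bool * bool)) := set3 t.1 t.2.1 t.2.2.
rewrite (reindex mk) /=; last first.
  exists (fun A : {set 'I_3} =>
    (ord0 \in A, (lift ord0 ord0 \in A, ord_max \in A))).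
    by case=> [a [b c]] _; rewrite !inE.
  by move=> A _; rewrite /mk /= -set3E.
rewrite [RHS](eq_bigr (fun a => \sum_(t : bool * bool) F (set3 a t.1 t.2))).
  by rewrite [RHS]pair_bigA.
by move=> a _; rewrite pair_bigA.
Qed.

Lemma enum_set3 a b c : enum (set3 a b c) =
  mask [:: a; b; c] [:: ord0; lift ord0 ord0; ord_max].
Proof.
have enum3 : enum 'I_3 = [:: ord0; lift ord0 ord0; ord_max].
  by apply: (inj_map val_inj); rewrite val_enum_ord.
rewrite /enum_mem -enumT enum3 /= !inE /=.
by case: a b c => [] [] [].
Qed.

(** * Principal minors and positive definiteness in dimension three *)

Lemma principal_minor_enum (R : realType) n (Theta : 'M[R]_n) (I : {set 'I_n})
    (s : seq 'I_n) (x : 'I_n) : enum I = s ->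
  principal_minor Theta I =
  \det (\matrix_(i < size s, j < size s) Theta (nth x s i) (nth x s j)).
Proof.
move=> <-; rewrite /principal_minor.
(* Generalizing the dimension to a variable [k] lets the equation with [#|I|] be substituted, so no
   cast of matrices is needed. *)
suff det_cast k (E : k = #|I|) :
    \det (principal_submx Theta I) =
    \det (\matrix_(i < k, j < k) Theta (nth x (enum I) i) (nth x (enum I) j)).
  by apply: det_cast; rewrite cardE.
subst k; congr (\det _); apply/matrixP => i j.
by rewrite !mxE -!(enum_val_nth x).
Qed.

Lemma det_mx22 (R : comPzRingType) (A : 'M[R]_2) :
  \det A = A ord0 ord0 * A ord_max ord_max - A ord0 ord_max * A ord_max ord0.
Proof.
rewrite (expand_det_row _ ord0) !big_ord_recl big_ord0 /cofactor !det_mx11 !mxE.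
have -> : lift ord0 ord0 = ord_max :> 'I_2 by apply: val_inj.
have -> : lift ord_max 0 = ord0 :> 'I_2 by apply: val_inj.
by rewrite /= expr0 expr1 mul1r mulN1r mulrN addr0.
Qed.

Definition sym3 (R : realType) (a b c x y z : R) : 'M[R]_3 :=
  \matrix_(i, j) nth 0 (nth [::] [:: [:: a; x; y]; [:: x; b; z]; [:: y; z; c]] i) j.

Lemma det_sym3 (R : realType) (a b c x y z : R) :
  \det (sym3 a b c x y z) =
  a * b * c + 2 * x * y * z - a * z ^+ 2 - b * y ^+ 2 - c * x ^+ 2.
Proof.
rewrite (expand_det_row _ ord0) !big_ord_recl big_ord0 /cofactor !det_mx22 !mxE /=.
ring.
Qed.

Lemma principal_minor_sym3 (R : realType) (a b c x y z : R) p q r :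
  principal_minor (sym3 a b c x y z) (set3 p q r) =
  if p then if q then if r then \det (sym3 a b c x y z) else a * b - x ^+ 2
            else if r then a * c - y ^+ 2 else a
  else if q then if r then b * c - z ^+ 2 else b
       else if r then c else 1.
Proof.
rewrite (principal_minor_enum _ ord0 (enum_set3 p q r)).
case: p q r => [] [] [] /=.
- by congr (\det _); apply/matrixP; do 2!apply: forall_ord3; rewrite !mxE.
all: rewrite ?det_mx22 ?det_mx11 ?det_mx00 ?mxE //=; ring.
Qed.

(** Sylvester's criterion, obtained by completing squares. *)
Lemma posdefmx_sym3 (R : realType) (a b c x y z : R) :
  0 < a -> 0 < a * b - x ^+ 2 -> 0 < \det (sym3 a b c x y z) ->
  posdefmx (sym3 a b c x y z).
Proof.
rewrite det_sym3; set m := a * b - x ^+ 2; set d := (X in _ -> _ -> 0 < X -> _).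
move=> a0 m0 d0; split.
  by apply/matrixP; do 2!apply: forall_ord3; rewrite !mxE.
move=> v; apply: contraNT; rewrite -leNgt.
set v0 := v ord0 0; set v1 := v (lift ord0 ord0) 0; set v2 := v ord_max 0.
have -> : (v^T *m sym3 a b c x y z *m v) 0 0 =
    a * v0 ^+ 2 + b * v1 ^+ 2 + c * v2 ^+ 2 +
    2 * (x * v0 * v1 + y * v0 * v2 + z * v1 * v2).
  rewrite !mxE !big_ord_recl big_ord0 !mxE !big_ord_recl !big_ord0 !mxE /=.
  rewrite -/v0 -/v1 (_ : lift ord0 (lift ord0 ord0) = ord_max) -/v2.
    by ring.
  exact: val_inj.
set Q := (Q in Q <= 0) => Qle0.
(* Lagrange's reduction to a sum of squares, cleared of denominators. The three linear forms are
   triangular in [v0], [v1], [v2], so they are solved from [v2] backwards. *)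
have QE : a * m * Q = m * (a * v0 + x * v1 + y * v2) ^+ 2 +
    (m * v1 + (a * z - x * y) * v2) ^+ 2 + a * d * v2 ^+ 2.
  by rewrite /Q /m /d; ring.
have : a * m * Q <= 0 by rewrite mulr_ge0_le0 // ltW // mulr_gt0.
rewrite QE => sq_le0.
have s0 : 0 <= m * (a * v0 + x * v1 + y * v2) ^+ 2.
  by rewrite mulr_ge0 ?sqr_ge0 // ltW.
have s1 := sqr_ge0 (m * v1 + (a * z - x * y) * v2).
have s2 : 0 <= a * d * v2 ^+ 2 by rewrite mulr_ge0 ?sqr_ge0 // ltW // mulr_gt0.
have v20 : v2 = 0.
  have /eqP : a * d * v2 ^+ 2 = 0 by lra.
  by rewrite mulf_eq0 gt_eqF ?mulr_gt0 //= sqrf_eq0 => /eqP.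
have v10 : v1 = 0.
  have /eqP : (m * v1 + (a * z - x * y) * v2) ^+ 2 = 0 by lra.
  by rewrite v20 mulr0 addr0 sqrf_eq0 mulf_eq0 gt_eqF //= => /eqP.
have v00 : v0 = 0.
  have /eqP : m * (a * v0 + x * v1 + y * v2) ^+ 2 = 0 by lra.
  by rewrite v20 v10 !mulr0 !addr0 mulf_eq0 gt_eqF //= sqrf_eq0 mulf_eq0
     gt_eqF //= => /eqP.
apply/eqP/matrixP => i j; rewrite (ord1 j) mxE.
by move: i; apply: forall_ord3.
Qed.

(** * Directional derivatives of the log-likelihood *)

Lemma is_derive_line (R : realType) (V : normedModType R) (f : V -> R)
    (a v : V) (df : R) :
  is_derive (0 : R) 1 (fun h => f (h *: v + a)) df -> is_derive a v f df.
Proof.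
(* The two difference quotients are the same function of [h], so both the existence and the value of
   the limit transfer. *)
have quotE : (fun h : R => h^-1 *:
      (((fun k => f (k *: v + a)) \o shift 0) (h *: 1) - f (0 *: v + a))) =
    (fun h => h^-1 *: ((f \o shift a) (h *: v) - f a)).
  by apply/funext => h /=; rewrite addr0 scale0r add0r [h%:A]mulr1.
by case; rewrite /derivable /derive quotE.
Qed.

(** Minors of a 3 x 3 matrix restricted to a line are polynomials of degree at most 3, whose
    derivative at 0 is the linear coefficient. *)
Lemma is_derive_cubic (R : realType) (f : R -> R) (m n k l : R) :
  (forall h, f h = m + n * h + k * h ^+ 2 + l * h ^+ 3) ->
  is_derive (0 : R) 1 f n.
Proof.
move=> fE.
have -> : f = horner (Poly [:: m; n; k; l]).
  by apply/funext => h; rewrite fE horner_Poly /=; ring.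
apply: is_derive_eq.
by rewrite horner_coef0 coef_deriv mulr1n coef_Poly.
Qed.

Lemma is_derive_log_likelihood (R : realType) n (u : {set 'I_n} -> R)
    (Theta V : 'M[R]_n) (dm : {set 'I_n} -> R) (dd : R) :
  (forall I, 0 < principal_minor Theta I) -> 0 < \det (Theta + 1%:M) ->
  (forall I, is_derive (0 : R) 1
     (fun h => principal_minor (h *: V + Theta) I) (dm I)) ->
  is_derive (0 : R) 1 (fun h => \det (h *: V + Theta + 1%:M)) dd ->
  is_derive Theta V (log_likelihood u)
    (\sum_I u I * (dm I / principal_minor Theta I)
     - (\sum_I u I) * (dd / \det (Theta + 1%:M))).
Proof.
move=> m0 d0 dmP ddP; apply: is_derive_line.
have is_derive_ln (f : R -> R) (df : R) : 0 < f 0 -> is_derive (0 : R) 1 f df ->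
    is_derive (0 : R) 1 (fun h => ln (f h)) (df / f 0).
  move=> f0 fP; rewrite mulrC.
  exact: (@is_derive1_comp _ _ _ _ _ _ (is_derive1_ln f0) fP).
apply: is_deriveB.
  rewrite -fct_sumE.
  elim/big_ind2 : _ => [|f df g dg fP gP|I _].
  - exact: is_derive_cst.
  - exact: is_deriveD.
  (* [Theta] is written as the point [h = 0] of the line, so that the denominator takes the form
     [f 0] of [is_derive_ln]. *)
  apply: is_deriveZ; rewrite -{2}(add0r Theta) -(scale0r V).
  by apply: is_derive_ln; rewrite // scale0r add0r.
apply: is_deriveZ; rewrite -{2}(add0r Theta) -(scale0r V).
by apply: (is_derive_ln (fun h => \det (h *: V + Theta + 1%:M))); rewrite // scale0r add0r.
Qed.

Lemma sym3_line (R : realType) (h a b c x y z a' b' c' x' y' z' : R) :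
  h *: sym3 a' b' c' x' y' z' + sym3 a b c x y z =
  sym3 (h * a' + a) (h * b' + b) (h * c' + c)
       (h * x' + x) (h * y' + y) (h * z' + z).
Proof. by apply/matrixP; do 2!apply: forall_ord3; rewrite !mxE. Qed.

Lemma sym3_add1 (R : realType) (a b c x y z : R) :
  sym3 a b c x y z + 1%:M = sym3 (a + 1) (b + 1) (c + 1) x y z.
Proof. by apply/matrixP; do 2!apply: forall_ord3; rewrite !mxE /= ?addr0. Qed.

Lemma sum_principal_minor_sym3 (R : realType) (a b c x y z : R) :
  \sum_I principal_minor (sym3 a b c x y z) I =
  \det (sym3 a b c x y z + 1%:M).
Proof.
rewrite sum_set3 !big_bool /= !principal_minor_sym3 sym3_add1 !det_sym3; ring.
Qed.

(** Jacobi's formula: the trace of the adjugate of the first matrix times the second. *)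
Definition ddet3 (R : realType) (a b c x y z a' b' c' x' y' z' : R) : R :=
  a' * (b * c - z ^+ 2) + b' * (a * c - y ^+ 2) + c' * (a * b - x ^+ 2) +
  2 * (x' * (y * z - c * x) + y' * (x * z - b * y) + z' * (x * y - a * z)).

Lemma is_derive_det_sym3 (R : realType) (a b c x y z a' b' c' x' y' z' : R) :
  is_derive (0 : R) 1
    (fun h => \det (h *: sym3 a' b' c' x' y' z' + sym3 a b c x y z))
    (ddet3 a b c x y z a' b' c' x' y' z').
Proof.
(* The quadratic coefficient is the linear one with the two matrices exchanged. *)
apply: (@is_derive_cubic _ _ (\det (sym3 a b c x y z)) _
  (ddet3 a' b' c' x' y' z' a b c x y z) (\det (sym3 a' b' c' x' y' z'))) => h.
by rewrite sym3_line !det_sym3 /ddet3; ring.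
Qed.

Definition dminor3 (R : realType) (a b c x y z a' b' c' x' y' z' : R)
    (p q r : bool) : R :=
  if p then if q then if r then ddet3 a b c x y z a' b' c' x' y' z'
                      else a' * b + a * b' - 2 * x * x'
            else if r then a' * c + a * c' - 2 * y * y' else a'
  else if q then if r then b' * c + b * c' - 2 * z * z' else b'
       else if r then c' else 0.

Lemma is_derive_principal_minor_sym3 (R : realType)
    (a b c x y z a' b' c' x' y' z' : R) p q r :
  is_derive (0 : R) 1
    (fun h => principal_minor (h *: sym3 a' b' c' x' y' z' + sym3 a b c x y z)
                              (set3 p q r))
    (dminor3 a b c x y z a' b' c' x' y' z' p q r).
Proof.
under eq_fun => h do rewrite sym3_line principal_minor_sym3 -sym3_line.
case: p q r => [] [] [] /=.
- exact: is_derive_det_sym3.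
- by apply: (@is_derive_cubic _ _ (a * b - x ^+ 2) _ (a' * b' - x' ^+ 2) 0) => h; ring.
- by apply: (@is_derive_cubic _ _ (a * c - y ^+ 2) _ (a' * c' - y' ^+ 2) 0) => h; ring.
- by apply: (@is_derive_cubic _ _ a _ 0 0) => h; ring.
- by apply: (@is_derive_cubic _ _ (b * c - z ^+ 2) _ (b' * c' - z' ^+ 2) 0) => h; ring.
- by apply: (@is_derive_cubic _ _ b _ 0 0) => h; ring.
- by apply: (@is_derive_cubic _ _ c _ 0 0) => h; ring.
- by apply: (@is_derive_cubic _ _ 1 _ 0 0) => h; ring.
Qed.

(** Reduces the six coordinate directions to a single computation in a generic symmetric
    direction. *)
Lemma sym_dir_sym3 (R : realType) (i j : 'I_3) :
  exists a b c x y z, sym_dir R i j = sym3 a b c x y z.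
Proof.
have symT : (sym_dir R i j)^T = sym_dir R i j.
  rewrite /sym_dir; case: eqP => [->|_]; first by rewrite trmx_delta.
  by rewrite linearD /= !trmx_delta addrC.
set S := sym_dir R i j in symT *.
have SE k l : S k l = S l k by rewrite -{1}symT mxE.
exists (S ord0 ord0), (S (lift ord0 ord0) (lift ord0 ord0)), (S ord_max ord_max),
  (S ord0 (lift ord0 ord0)), (S ord0 ord_max), (S (lift ord0 ord0) ord_max).
by apply/matrixP; do 2!apply: forall_ord3; rewrite !mxE //= SE.
Qed.

(** * The data, the critical point and the failure to decouple *)

Lemma data_in_dpp_model_principal_minor (R : realType) (a b c x y z : R) :
  let Sigma := sym3 a b c x y z in
  posdefmx Sigma -> (forall I, 0 <= principal_minor Sigma I) ->
  data_in_dpp_model (principal_minor Sigma).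
Proof.
move=> Sigma posS minS.
have sum_gt0 : 0 < \sum_J principal_minor Sigma J.
  (* The empty minor equals 1, which makes the sum strictly positive. *)
  rewrite (bigD1 finset.set0) //= ltr_pwDl ?sumr_ge0 //.
  by rewrite set0_set3 principal_minor_sym3.
split=> //; split; last first.
  by exists Sigma; split=> // I; rewrite -sum_principal_minor_sym3.
split=> [I|]; first by rewrite divr_ge0 // ltW.
by rewrite -mulr_suml divff // gt_eqF.
Qed.

(* With r = sqrt 15, Sigma = (1 + B) / (1 - B) for the matrix B supported on the
   path 1 - 2 - 3 with weights r / 8, 1 / 2. *)
Definition Sigma_ex (R : realType) : 'M[R]_3 :=
  let r := Num.sqrt 15 in
  sym3 (21 / 11) (95 / 33) (65 / 33) (16 * r / 33) (8 * r / 33) (64 / 33).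

(* Theta = (1 + B) / (1 - B) for the matrix B supported on the path 2 - 1 - 3
   with weights 1 / 2, 1 / 4. *)
Definition Theta_ex (R : realType) : 'M[R]_3 :=
  sym3 (21 / 11) (19 / 11) (13 / 11) (16 / 11) (8 / 11) (4 / 11).

(** The root enters only through its square, so the values are rational. They are invariant under
    complementation, which is the symmetry s -> -s. *)
Lemma principal_minor_Sigma_ex (R : realType) p q r :
  principal_minor (Sigma_ex R) (set3 p q r) =
  if p then if q then if r then 1 else 65 / 33
            else if r then 95 / 33 else 21 / 11
  else if q then if r then 21 / 11 else 95 / 33
       else if r then 65 / 33 else 1.
Proof.
have r2 : Num.sqrt (15 : R) ^+ 2 = 15 by rewrite sqr_sqrtr.
rewrite principal_minor_sym3 det_sym3.
by case: p q r => [] [] [] //; field: r2.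
Qed.

Lemma principal_minor_Theta_ex (R : realType) p q r :
  principal_minor (Theta_ex R) (set3 p q r) =
  if p then if q then if r then 1 else 13 / 11
            else if r then 19 / 11 else 21 / 11
  else if q then if r then 21 / 11 else 19 / 11
       else if r then 13 / 11 else 1.
Proof.
rewrite principal_minor_sym3 det_sym3.
by case: p q r => [] [] [] //; field.
Qed.

Lemma data_in_dpp_model_Sigma_ex (R : realType) : data_in_dpp_model (principal_minor (Sigma_ex R)).
Proof.
have minS p q r : 0 < principal_minor (Sigma_ex R) (set3 p q r).
  by rewrite principal_minor_Sigma_ex; case: p q r => [] [] [] //; lra.
apply: data_in_dpp_model_principal_minor => [|I]; last first.
  by rewrite [I]set3E ltW.
apply: posdefmx_sym3; first by lra.
  by have := minS true true false; rewrite principal_minor_sym3.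
by have := minS true true true; rewrite principal_minor_sym3.
Qed.

Lemma critical_point_Theta_ex (R : realType) :
  critical_point (principal_minor (Sigma_ex R)) (Theta_ex R).
Proof.
have minT p q r : 0 < principal_minor (Theta_ex R) (set3 p q r).
  by rewrite principal_minor_Theta_ex; case: p q r => [] [] [] //; lra.
split.
  apply: posdefmx_sym3; first by lra.
    by have := minT true true false; rewrite principal_minor_sym3.
  by have := minT true true true; rewrite principal_minor_sym3.
move=> i j _; have [a' [b' [c' [x' [y' [z' ->]]]]]] := sym_dir_sym3 R i j.
have detE : \det ((Theta_ex R) + 1%:M) = 128 / 11.
  by rewrite sym3_add1 det_sym3; field.
pose dm := dminor3 (21 / 11) (19 / 11) (13 / 11) (16 / 11) (8 / 11) (4 / 11)
  a' b' c' x' y' z'.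
have dmP (I : {set 'I_3}) : is_derive (0 : R) 1
    (fun h => principal_minor (h *: sym3 a' b' c' x' y' z' + (Theta_ex R)) I)
    (dm (ord0 \in I) (lift ord0 ord0 \in I) (ord_max \in I)).
  rewrite {1}[I]set3E; exact: is_derive_principal_minor_sym3.
have ddP : is_derive (0 : R) 1
    (fun h => \det (h *: sym3 a' b' c' x' y' z' + (Theta_ex R) + 1%:M))
    (ddet3 (21 / 11 + 1) (19 / 11 + 1) (13 / 11 + 1) (16 / 11) (8 / 11) (4 / 11)
       a' b' c' x' y' z').
  under eq_fun => h do rewrite -addrA sym3_add1.
  exact: is_derive_det_sym3.
have minT' I : 0 < principal_minor (Theta_ex R) I by rewrite [I]set3E.
have detT : 0 < \det ((Theta_ex R) + 1%:M) by rewrite detE; lra.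
apply: is_derive_eq (is_derive_log_likelihood (principal_minor (Sigma_ex R)) minT' detT dmP ddP) _.
(* What remains is a linear form in the six entries of the direction, all of whose coefficients
   vanish. *)
rewrite detE !sum_set3 !big_bool /= !inE /= !principal_minor_Sigma_ex
  !principal_minor_Theta_ex /dm /dminor3 /ddet3.
by field.
Qed.

Lemma not_partial_decoupling_Theta_ex (R : realType) :
  ~ partial_decoupling (principal_minor (Sigma_ex R)) (Theta_ex R).
Proof.
case=> P partP [_ block minors].
have coverP i : i \in finset.cover P by rewrite (finset.cover_partition partP) inE.
set B := finset.pblock P ord0.
have BP : B \in P by rewrite finset.pblock_mem.
(* The first column of [Theta_ex] has no zero entry, so no index can lie in a block other than that
   of [ord0]. *)
have BT : B = [set: 'I_3].
  apply/setP => i; rewrite inE.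
  have [<-|neq] := eqVneq (finset.pblock P i) B; first by rewrite finset.mem_pblock coverP.
  have := block _ _ (finset.pblock_mem (coverP i)) BP neq i ord0.
  rewrite !finset.mem_pblock !coverP => /(_ isT isT).
  by move: i {neq}; apply: forall_ord3; rewrite mxE /=; lra.
have marginalE J : marginal (principal_minor (Sigma_ex R)) B J =
    principal_minor (Sigma_ex R) J.
  rewrite /marginal BT; under eq_bigl => I do rewrite finset.setIT.
  by rewrite big_pred1_eq.
(* With a single block all minors would have to agree with the data, but at {2} they are 19/11 and
   95/33. *)
have := minors B (set3 false true false) BP.
rewrite BT finset.subsetT -BT !marginalE set0_set3 => /(_ isT).
by rewrite principal_minor_Theta_ex !principal_minor_Sigma_ex /=; lra.
Qed.

Theorem proposition2p2 (R : realType) :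
  (exists u : {set 'I_3} -> R, data_in_dpp_model u /\
     exists Theta : 'M[R]_3, critical_point u Theta /\ ~ partial_decoupling u Theta) /\
  ~ (forall (n : nat) (u : {set 'I_n} -> R), data_in_dpp_model u ->
       forall Theta : 'M[R]_n, critical_point u Theta -> partial_decoupling u Theta).
Proof.
have uP := data_in_dpp_model_Sigma_ex R.
have critT := critical_point_Theta_ex R.
have notT := @not_partial_decoupling_Theta_ex R.
split; last by move=> conj; apply/notT/conj.
by exists (principal_minor (Sigma_ex R)); split=> //; exists (Theta_ex R).
Qed.
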